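(* Let $\alpha$ be a weak composition of $n\ge1$ and $\delta$ any weak composition. The statistics $\mathrm{flex}$ and $\mathrm{maj}$ are equidistributed modulo $n$ on $\mathcal{W}_{\alpha,\delta}$, i.e. $\sum_{w\in\mathcal{W}_{\alpha,\delta}}q^{\mathrm{flex}(w)}\equiv\sum_{w\in\mathcal{W}_{\alpha,\delta}}q^{\mathrm{maj}(w)}\pmod{q^n-1}$.
   Context: A word of length $n$ is a sequence $w=w_1\cdots w_n$ of positive integers; its content is the sequence whose $j$-th entry is the number of $j$'s. $\mathrm{maj}(w)=\sum_{1\le i<n,\,w_i>w_{i+1}}i$. $\mathrm{cdes}(w)=\#\{1\le i\le n:w_i>w_{i+1}\}$ with indices mod $n$ (empty word: 0). $w^{(i)}$ is the subsequence of letters $\le i$. For $w$ of content $\alpha$ with $m$ parts, $\mathrm{CDT}(w)=(\mathrm{cdes}(w^{(1)}),\mathrm{cdes}(w^{(2)})-\mathrm{cdes}(w^{(1)}),\dots,\mathrm{cdes}(w^{(m)})-\mathrm{cdes}(w^{(m-1)}))$, and $\mathcal{W}_{\alpha,\delta}$ is the set of words with content $\alpha$ and $\mathrm{CDT}=\delta$. The necklace $[w]$ is the orbit of $w$ under rotation $w_1\cdots w_{n-1}w_n\mapsto w_nw_1\cdots w_{n-1}$. $\mathrm{freq}(w)$ is the largest $f$ with $w=v^f$ for some word $v$; $\mathrm{lex}(w)$ is the position of $w$, starting from $0$, in the increasing lexicographic listing of $[w]$; $\mathrm{flex}(w)=\mathrm{freq}(w)\mathrm{lex}(w)$. *)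

(* Defs.v *)
From mathcomp Require Import all_boot all_order all_algebra.

Set Implicit Arguments.
Unset Strict Implicit.
Unset Printing Implicit Defensive.

Import Order.TTheory GRing.Theory.

(* A word is a [seq nat] all of whose letters are positive.  The mathematical
   w_1 ... w_n is 1-indexed, so w_i is [nth 0 w i.-1]. *)

Definition is_word (w : seq nat) : bool := all (fun a => 0 < a) w.

(* Only the number m of parts is needed to make the content a finite sequence:
   trailing zeros of a weak composition are significant. *)
Definition content (m : nat) (w : seq nat) : seq nat :=
  [seq count_mem j w | j <- iota 1 m].

Definition has_content (alpha w : seq nat) : bool :=
  all (fun a => a <= size alpha) w && (content (size alpha) w == alpha).

Definition maj (w : seq nat) : nat :=
  \sum_(1 <= i < size w | nth 0 w i.-1 > nth 0 w i) i.

Definition cdes (w : seq nat) : nat :=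
  \sum_(i < size w) (nth 0 w i > nth 0 w (i.+1 %% size w)).

Definition restrict (i : nat) (w : seq nat) : seq nat := [seq a <- w | a <= i].

(* The differences are taken in int, so that no subtraction is truncated.
   The first entry is cdes (w^(1)) because w^(0) is the empty word. *)
Definition CDT (m : nat) (w : seq nat) : seq int :=
  [seq ((cdes (restrict j w))%:Z - (cdes (restrict j.-1 w))%:Z)%R
  | j <- iota 1 m].

Definition inW (alpha delta w : seq nat) : bool :=
  [&& is_word w, has_content alpha w & CDT (size alpha) w == map Posz delta].

(* A duplicate-free list of the words in W_(alpha, delta); see [mem_W] and
   [uniq_W].  The words of content alpha are the rearrangements of
   1^(alpha_1) 2^(alpha_2) ... m^(alpha_m). *)
Definition base_word (alpha : seq nat) : seq nat :=
  flatten [seq nseq (nth 0 alpha j.-1) j | j <- iota 1 (size alpha)].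

Definition W (alpha delta : seq nat) : seq (seq nat) :=
  [seq w <- permutations (base_word alpha) | inW alpha delta w].

(* w_1 ... w_(n-1) w_n |-> w_n w_1 ... w_(n-1) is [rotr 1].  The orbit has at
   most n elements; iterating once more only serves the empty word. *)
Definition necklace (w : seq nat) : seq (seq nat) :=
  undup (traject (rotr 1) w (size w).+1).

Definition lex (w : seq nat) : nat :=
  index w (sort (fun u v : seqlexi nat => (u <= v)%O) (necklace w)).

Definition wpow (v : seq nat) (f : nat) : seq nat := flatten (nseq f v).

(* If w = v^f with f > 0 then v is a prefix of w, so only prefixes need be
   tried; see [is_wpowP] and [freqP]. *)
Definition is_wpow (w : seq nat) (f : nat) : bool :=
  has (fun k => w == wpow (take k w) f) (iota 0 (size w).+1).

Definition freq (w : seq nat) : nat :=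
  \max_(f < (size w).+1 | is_wpow w f) f.

Definition flex (w : seq nat) : nat := freq w * lex w.

Definition eq_mod_poly (d p q : {poly int}) : Prop :=
  exists r : {poly int}, (p - q = r * d)%R.

Lemma count_base_word alpha a :
  count_mem a (base_word alpha) =
  if 0 < a <= size alpha then nth 0 alpha a.-1 else 0.
Proof.
rewrite /base_word count_flatten -map_comp sumnE big_map.
under eq_bigr => j _ do rewrite /= count_nseq /=.
have -> : (0 < a <= size alpha) = (a \in iota 1 (size alpha)).
  by rewrite mem_iota add1n ltnS.
case: ifPn => [a_in | a_notin].
  rewrite (bigD1_seq a) ?iota_uniq //= eqxx mul1n big1 ?addn0 // => j.
  by move=> /negPf->; rewrite mul0n.
rewrite big_seq big1 // => j j_in.
by rewrite (negPf (memPn a_notin j j_in)) mul0n.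
Qed.

Lemma perm_base_word alpha w :
  is_word w -> has_content alpha w -> perm_eq w (base_word alpha).
Proof.
move=> /allP wpos /andP[/allP wle /eqP wc].
apply/allP => a _; apply/eqP; rewrite count_base_word; case: ifPn => [/andP[a0 am]|].
  rewrite -{1}wc (nth_map 0) ?size_iota ?prednK //.
  by rewrite nth_iota ?prednK // add1n prednK.
move=> aN; apply/count_memPn; apply: contra aN => aw.
by rewrite wpos //= wle.
Qed.

Lemma mem_W alpha delta w : (w \in W alpha delta) = inW alpha delta w.
Proof.
rewrite mem_filter; case: (boolP (inW _ _ _)) => //= /and3P[w1 w2 _].
by rewrite mem_permutations perm_base_word.
Qed.

Lemma uniq_W alpha delta : uniq (W alpha delta).
Proof. exact/filter_uniq/permutations_uniq. Qed.

Lemma size_wpow v f : size (wpow v f) = f * size v.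
Proof. by rewrite /wpow size_flatten /shape map_nseq sumn_nseq mulnC. Qed.

Lemma is_wpowP w f : reflect (exists v, w = wpow v f) (is_wpow w f).
Proof.
apply: (iffP hasP) => [[k _ /eqP->]|[v wE]]; first by exists (take k w).
case: f => [|f] in wE *; first by exists 0; rewrite // wE.
exists (size v); last by rewrite {2}wE [in take _ _]/wpow /= take_size_cat // {1}wE.
by rewrite mem_iota /= add0n ltnS wE size_wpow leq_pmull.
Qed.

Lemma freqP w : 0 < size w ->
  (exists v, w = wpow v (freq w)) /\
  (forall f v, w = wpow v f -> f <= freq w).
Proof.
move=> w_gt0; split.
  apply/is_wpowP; rewrite /freq.
  have w1 : is_wpow w 1 by apply/is_wpowP; exists w; rewrite /wpow /= cats0.
  pose i1 := @Ordinal (size w).+1 1 w_gt0.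
  rewrite (bigop.bigmax_eq_arg i1 w1).
  by case: (@arg_maxnP _ i1 (fun f => is_wpow w f) (@nat_of_ord _) w1).
move=> f v wE.
have flt : f < (size w).+1.
  rewrite ltnS; move: w_gt0; rewrite wE size_wpow muln_gt0 => /andP[_ v0].
  exact: leq_pmulr.
have wf : is_wpow w f by apply/is_wpowP; exists v.
exact: (leq_bigmax_cond (Ordinal flt) wf).
Qed.

Lemma necklaceP w u :
  reflect (exists k, u = iter k (rotr 1) w) (u \in necklace w).
Proof.
rewrite mem_undup.
have iter_rot k : k <= size w -> iter k (rot 1) w = rot k w.
  elim: k => [|k IH] kw; first by rewrite rot0.
  by rewrite iterS IH 1?ltnW // -rotS.
have iter_rotK k v : iter k (rotr 1) (iter k (rot 1) v) = v.
  by elim: k => //= k IH; rewrite -iterS iterSr rotK.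
have iter_size : iter (size w) (rotr 1) w = w.
  by rewrite -{2}(rot_size w) -iter_rot.
have loop : looping (rotr 1) w (size w).+1.
  rewrite /looping iterS iter_size.
  by case: w {iter_rot iter_size} => [|a w]; rewrite !inE eqxx ?orbT.
apply: (iffP trajectP) => [[k _ ->]|[k ->]]; first by exists k.
by have /loopingP/(_ k)/trajectP := loop.
Qed.

(* Main.v *)
(* Let n be the length of the words.  Both generating functions are compared at
   the n-th roots of unity: if x is a primitive d-th root of unity and d | n, each
   of them takes as value the number of words of W_(alpha, delta) fixed by the
   rotation by n/d letters, i.e. of the words v^d in W_(alpha, delta).

   For flex this is a geometric sum over each necklace.  For maj, rotating a word
   changes maj by the total cyclic descent number c modulo n.  If d does not
   divide c, both numbers vanish.  Otherwise x^maj is rotation invariant, and it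
   suffices to sum over the words w starting with their smallest letter a.  For
   these, c and maj (modulo n) are the descent number and the major index of the
   linear word w a, and inserting the copies of the next letter into the gaps of
   w a multiplies the generating function by a power of x and two q-binomial
   coefficients.  By the q-Lucas theorem each factor vanishes at x unless d divides
   the new entries of alpha and delta, and otherwise equals its value at q = 1 for
   alpha/d and delta/d; so the sum counts the words v with these data. *)

Require Import Defs.
From mathcomp Require Import all_boot all_order all_algebra all_field.
From mathcomp Require Import zify ring.

Set Implicit Arguments.
Unset Strict Implicit.
Unset Printing Implicit Defensive.
Import Order.TTheory GRing.Theory Num.Theory.

(** * q-binomial coefficients and the q-Lucas theorem *)

Section QBinomial.
Variables (R : comNzRingType) (x : R).
Local Open Scope ring_scope.

(** The Gaussian binomial coefficient at q = [x]. The q-Pascal rule keeps it defined at roots of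
    unity, where a quotient of q-factorials may be 0/0. *)
Fixpoint qbin (n k : nat) : R :=
  match k, n with
  | 0%N, _ => 1
  | _.+1, 0%N => 0
  | k'.+1, n'.+1 => x ^+ k * qbin n' k + qbin n' k'
  end.

Lemma qbin0 n : qbin n 0 = 1.
Proof. by case: n. Qed.

Lemma qbinS n k : qbin n.+1 k.+1 = x ^+ k.+1 * qbin n k.+1 + qbin n k.
Proof. by []. Qed.

Lemma qbin_small n k : (n < k)%N -> qbin n k = 0.
Proof.
elim: n k => [|n IH] [|k] // nk.
by rewrite qbinS !IH ?mulr0 ?addr0 //; lia.
Qed.

Lemma qbinn n : qbin n n = 1.
Proof. by elim: n => // n IH; rewrite qbinS IH qbin_small // mulr0 add0r. Qed.

Lemma qbinS' n k : (k <= n)%N ->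
  qbin n.+1 k.+1 = qbin n k.+1 + x ^+ (n - k) * qbin n k.
Proof.
elim: n k => [|n IH] k kn.
  by case: k kn => // _; rewrite /= mulr0 add0r expr0 mul1r add0r.
rewrite leq_eqVlt in kn; case/orP: kn => [/eqP->|kn].
  by rewrite subnn !qbinn qbin_small // add0r mul1r.
rewrite qbinS [in LHS]IH //; case: k => [|k] in kn *.
  by rewrite (qbinS n 0) !qbin0 !subn0 !exprS expr0; ring.
rewrite [in LHS](IH k); last by lia.
rewrite (qbinS n k.+1) (qbinS n k).
have -> : (n - k = (n - k.+1).+1)%N by lia.
have -> : (n.+1 - k.+1 = (n - k.+1).+1)%N by lia.
rewrite !exprS; ring.
Qed.

(** Subtracting [x ^+ k.+1] times the rule [qbinS'] from the rule [qbinS] cancels [qbin n k.+1]. *)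
Lemma qbin_absorb n k :
  (1 - x ^+ k.+1) * qbin n.+1 k.+1 = (1 - x ^+ n.+1) * qbin n k.
Proof.
have [kn|nk] := leqP k n; last by rewrite !qbin_small ?mulr0 //; lia.
have E := qbinS n k; have E' := qbinS' kn.
rewrite mulrBl mul1r {1}E E' mulrDr mulrA -exprD.
have -> : (k.+1 + (n - k) = n.+1)%N by lia.
ring.
Qed.

End QBinomial.

Lemma qbin1 (R : comNzRingType) n k : qbin (1%R : R) n k = ('C(n, k)%:R)%R.
Proof.
elim: n k => [|n IH] [|k] //.
by rewrite qbinS !IH expr1n mul1r binS natrD.
Qed.

Section QLucas.
Variables (F : fieldType) (x : F) (d : nat).
Local Open Scope ring_scope.
Hypothesis x_prim : d.-primitive_root x.

Let d_gt0 : (0 < d)%N. Proof. exact: prim_order_gt0 x_prim. Qed.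

(** In [qbin_absorb] the right side contains 1 - x^d = 0, while 1 - x^s is nonzero for 0 < s < d. *)
Lemma qbin_prim s : (0 < s < d)%N -> qbin x d s = 0.
Proof.
case: s => // s /andP[_ sd]; have := qbin_absorb x d.-1 s.
rewrite prednK // (prim_expr_order x_prim) subrr mul0r => /eqP.
rewrite mulf_eq0 subr_eq0 eq_sym -(prim_order_dvd x_prim) => /orP[/dvdn_leq|/eqP //].
by move=> /(_ isT); lia.
Qed.

Lemma qbin_lucas a b j s : (b < d)%N -> (s < d)%N ->
  qbin x (a * d + b) (j * d + s) = 'C(a, j)%:R * qbin x b s.
Proof.
(* One Pascal step preserves the Lucas formula up to a carry, which occurs only on reaching a row
   divisible by [d], in a column that is a positive multiple of [d]. *)
have step A b0 : (b0 < d)%N ->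
    (forall j s, (s < d)%N ->
      qbin x (A * d + b0) (j * d + s) = 'C(A, j)%:R * qbin x b0 s) ->
    forall j s, (s < d)%N -> qbin x (A * d + b0).+1 (j * d + s) =
      'C(A, j)%:R * qbin x b0.+1 s +
      ((b0.+1 == d) && (s == 0%N) && (0 < j)%N)%:R * 'C(A, j.-1)%:R.
  move=> b0d H {}j [|{}s] sd; last first.
    rewrite andbF mul0r addr0 addnS qbinS -addnS !H // ?(ltnW sd) //.
    rewrite exprD mulnC exprM (prim_expr_order x_prim) expr1n mul1r /=; ring.
  case: j => [|j].
    by rewrite mul0n !qbin0 bin0 andbF mul0r addr0 mulr1.
  have -> : (j.+1 * d + 0 = (j * d + d.-1).+1)%N by lia.
  rewrite qbinS (_ : (j * d + d.-1).+1 = j.+1 * d + 0)%N; last by lia.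
  rewrite !H // ?prednK // addn0 mulnC exprM (prim_expr_order x_prim) expr1n mul1r.
  rewrite !qbin0 andbT /=; case: eqP => [b0E|b0E].
    by rewrite (_ : b0 = d.-1) ?qbinn ?mulr1 ?mul1r; last lia.
  by rewrite (@qbin_small _ _ b0) ?mulr0 ?mul0r ?mulr1 ?mul1r; last lia.
(* At the end of each block of [d] rows the carry turns 'C(A, j) into 'C(A.+1, j), and [qbin_prim]
   kills the columns with s > 0. *)
have main A : forall j s, (s < d)%N ->
    qbin x (A * d) (j * d + s) = 'C(A, j)%:R * qbin x 0 s.
  elim: A => [|A IH] {}j {}s sd.
    case: j => [|j]; first by rewrite mul0n add0n bin0 mul1r.
    by rewrite qbin_small ?bin0n ?mul0r //; lia.
  have H b0 : (b0 < d)%N -> forall j s, (s < d)%N ->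
      qbin x (A * d + b0) (j * d + s) = 'C(A, j)%:R * qbin x b0 s.
    elim: b0 => [|b0 IHb] b0d j0 s0 s0d; first by rewrite addn0 IH.
    rewrite addnS step // ?(ltn_eqF b0d) ?mul0r ?addr0 //; first exact: ltnW.
    exact/IHb/ltnW.
  have -> : (A.+1 * d = (A * d + d.-1).+1)%N by lia.
  rewrite step ?prednK //; last by apply: H; rewrite prednK.
  rewrite eqxx /=; case: s sd => [|s] sd /=.
    rewrite !qbin0 !mulr1; case: j => [|j]; first by rewrite !bin0 mul0r addr0.
    by rewrite binS natrD mul1r.
  by rewrite qbin_prim // !mulr0 mul0r addr0.
elim: b j s => [|b IH] j s bd sd; first by rewrite addn0 main.
rewrite addnS step ?(ltn_eqF bd) ?mul0r ?addr0 //; first exact: ltnW.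
by move=> *; apply: IH => //; exact: ltnW.
Qed.

End QLucas.

Arguments qbin : simpl never.

(** * Inserting copies of the largest letter *)

(** The default [b] of [head] makes the last letter contribute no descent. *)
Fixpoint des (z : seq nat) : nat :=
  if z is b :: s then (head b s < b) + des s else 0.

(* Prepending a letter moves every descent one step to the right, so that the
   positions of the descents of [s] increase by [des s] in total. *)
Fixpoint lmaj (z : seq nat) : nat :=
  if z is b :: s then lmaj s + des z else 0.

Lemma des_lt_size b s : des (b :: s) <= size s.
Proof. by elim: s b => [|a s IH] b /=; [rewrite ltnn | have := IH a => /=; case: ltnP; lia]. Qed.

Section Insertion.
Variable M : nat.

(* [insert_in u k] lists the words obtained from [u] by inserting [k] copies of
   [M] strictly between its first and last letters; [insert_front (insert_in u) k]
   lists those that in addition put at least one of them before the first. *)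
Fixpoint insert_front (f : nat -> seq (seq nat)) (k : nat) : seq (seq nat) :=
  if k is k'.+1 then map (cons M) (insert_front f k' ++ f k') else [::].

Fixpoint insert_in (u : seq nat) (k : nat) : seq (seq nat) :=
  match u with
  | [::] => [::]
  | [:: b] => if k is 0 then [:: [:: b]] else [::]
  | b :: u' => map (cons b) (insert_front (insert_in u') k ++ insert_in u' k)
  end.

Lemma insert_in_cons2 b b' u k : insert_in [:: b, b' & u] k =
  map (cons b) (insert_front (insert_in (b' :: u)) k ++ insert_in (b' :: u) k).
Proof. by []. Qed.

Lemma insert_in_head b u k s : s \in insert_in (b :: u) k -> exists t, s = b :: t.
Proof.
case: u => [|b' u]; first by case: k => // /[1!inE] /eqP->; exists [::].
by rewrite insert_in_cons2 => /mapP[t _ ->]; exists t.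
Qed.

Lemma insert_front_head f k s : s \in insert_front f k -> exists t, s = M :: t.
Proof. by case: k => // k /mapP[t _ ->]; exists t. Qed.

(** A run of copies of the largest letter ends in a descent, so filling a gap keeps its descent or
    creates one, and a run in front always creates one. *)
Lemma des_insert b u k : all (fun a => a < M) (b :: u) ->
  {in insert_in (b :: u) k, forall s, des (b :: u) <= des s} /\
  {in insert_front (insert_in (b :: u)) k, forall s, des (b :: u) < des s}.
Proof.
have front c v : c < M ->
  (forall k, {in insert_in (c :: v) k, forall s, des (c :: v) <= des s}) ->
  forall k, {in insert_front (insert_in (c :: v)) k, forall s, des (c :: v) < des s}.
  move=> cM H; elim=> // j IH s /mapP[t + ->]; rewrite mem_cat => /orP[tF|tI].
    by rewrite (leq_trans (IH _ tF)) //= leq_addl.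
  have := H _ _ tI; have [t' ->] := insert_in_head tI.
  by rewrite /= cM add1n ltnS.
elim: u b k => [|b' u IH] b k /= /andP[bM uM].
  have H j : {in insert_in [:: b] j, forall s, des [:: b] <= des s}.
    by case: j => // s /[1!inE] /eqP->.
  by split=> [s|]; [exact: H | exact: (front _ _ bM H)].
have H j : {in insert_in [:: b, b' & u] j, forall s, des [:: b, b' & u] <= des s}.
  have [I1 I2] := IH _ j uM; move=> s; rewrite insert_in_cons2 => /mapP[t + ->].
  rewrite mem_cat => /orP[tF|tI].
    have /= := I2 _ tF; lia.
  have /= := I1 _ tI; have [t' ->] := insert_in_head tI; rewrite /=; lia.
by split=> [s|]; [exact: H | exact: (front _ _ bM H)].
Qed.

Variables (R : comNzRingType) (x : R).
Local Open Scope ring_scope.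
Local Notation qb := (qbin x).

(* The factor by which inserting [k] copies of [M] multiplies x^lmaj when the
   word has [c] descents and [A] other gaps, and [e] new descents are created;
   [front_gf] is its analogue for the words starting with [M], whose first
   descent makes [e.+1] new ones. *)
Definition ins_gf A c k e : R :=
  if (k < e)%N then 0 else
  x ^+ ((c + e) * e + k) * qb A e * qb (c + k).-1 (k - e).

Definition front_gf A c k e : R :=
  if (k <= e)%N then 0 else
  x ^+ ((c + e) * e.+1 + k) * qb A e * qb (c + k).-1 (k.-1 - e).

(** Mirrors the removal of the leading [M]: the rest starts with [M] again or with the first
    original letter, and the power of [x] records the descents of the longer word. *)
Lemma front_gfS A c k e :
  front_gf A c k.+1 e = x ^+ (c + e).+1 * (front_gf A c k e + ins_gf A c k e).
Proof.
rewrite /front_gf /ins_gf /=.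
case: (ltngtP k e) => ke; first by rewrite addr0 mulr0.
  have -> : (k - e = (k.-1 - e).+1)%N by lia.
  have -> : ((c + k.+1).-1 = (c + k).-1.+1)%N by lia.
  rewrite qbinS'; last by lia.
  have -> : ((c + k).-1 - (k.-1 - e) = c + e)%N by lia.
  rewrite !mulrDr addrC; congr (_ + _).
    rewrite mulrCA !mulrA -!exprD.
    by congr (x ^+ _ * _ * _); lia.
  rewrite !mulrA -!exprD.
  by congr (x ^+ _ * _ * _); lia.
rewrite ke subnn !qbin0 !mulr1 add0r mulrA -exprD.
by congr (x ^+ _ * _); lia.
Qed.

(** Mirrors prepending a letter larger than the next one. Whether or not copies of [M] enter the new
    gap, it holds one descent, so [e] is the same in both terms. *)
Lemma ins_gf_desc A c k e :
  x ^+ c.+1 * ins_gf A c.+1 k e =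
  x ^+ (c.+1 + e) * (front_gf A c k e + ins_gf A c k e).
Proof.
rewrite /front_gf /ins_gf ltnNge; case: (ltngtP k e) => ke /=.
- by rewrite addr0 !mulr0.
- have -> : (k - e = (k.-1 - e).+1)%N by lia.
  rewrite [in qb (c + k) _](_ : (c + k = (c + k).-1.+1)%N); last by lia.
  rewrite qbinS'; last by lia.
  have -> : ((c + k).-1 - (k.-1 - e) = c + e)%N by lia.
  rewrite !mulrDr addrC; congr (_ + _).
    rewrite [X in x ^+ c.+1 * X]mulrCA !mulrA -!exprD.
    by congr (x ^+ _ * _ * _); lia.
  rewrite !mulrA -!exprD.
  by congr (x ^+ _ * _ * _); lia.
rewrite ke subnn !qbin0 !mulr1 add0r !mulrA -!exprD.
by congr (x ^+ _ * _); lia.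
Qed.

Lemma ins_gf_asc0 A c k : ins_gf A.+1 c k 0 = ins_gf A c k 0.
Proof. by rewrite /ins_gf !qbin0. Qed.

(** Mirrors prepending a letter not larger than the next one: filling the new gap uses up one of the
    [e.+1] new descents. *)
Lemma ins_gf_asc A c k e :
  x ^+ c * ins_gf A.+1 c k e.+1 =
  x ^+ (c + e.+1) * (front_gf A c k e + ins_gf A c k e.+1).
Proof.
rewrite /front_gf /ins_gf leqNgt ltnS; case: leqP => ek /=.
  by rewrite addr0 !mulr0.
rewrite qbinS (_ : (k - e.+1 = k.-1 - e)%N); last by lia.
rewrite mulrDr mulrDl mulrDr addrC mulrDr; congr (_ + _).
  by rewrite !mulrA -!exprD; congr (x ^+ _ * _ * _); lia.
by rewrite !mulrA -!exprD; congr (x ^+ _ * _ * _); lia.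
Qed.

Let S (L : seq (seq nat)) (r : nat) : R := \sum_(s <- L | des s == r) x ^+ lmaj s.

(** Prepending a letter adds the final descent number to [lmaj], a constant once that number is
    fixed, so the sums obey the recursions above. The two claims go together because filling the
    first gap is an insertion in front of the tail. *)
Lemma insert_gf b u : all (fun a => (a < M)%N) (b :: u) -> forall k e,
  S (insert_in (b :: u) k) (des (b :: u) + e) =
    x ^+ lmaj (b :: u) * ins_gf (size u - des (b :: u)) (des (b :: u)) k e
  /\ S (insert_front (insert_in (b :: u)) k) (des (b :: u) + e).+1 =
    x ^+ lmaj (b :: u) * front_gf (size u - des (b :: u)) (des (b :: u)) k e.
Proof.
have front c v : (c < M)%N ->
  (forall k e, S (insert_in (c :: v) k) (des (c :: v) + e) =
    x ^+ lmaj (c :: v) * ins_gf (size v - des (c :: v)) (des (c :: v)) k e) ->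
  forall k e, S (insert_front (insert_in (c :: v)) k) (des (c :: v) + e).+1 =
    x ^+ lmaj (c :: v) * front_gf (size v - des (c :: v)) (des (c :: v)) k e.
  move=> cM H; elim=> [|k IH] e; first by rewrite /S /= big_nil /front_gf mulr0.
  rewrite /S /= big_map big_cat front_gfS mulrCA mulrDr -IH -H mulrDr.
  congr (_ + _); rewrite /S big_distrr big_seq_cond [RHS]big_seq_cond /=.
    apply: eq_big => s.
      case: (boolP (s \in _)) => //= /insert_front_head[t ->] /=.
      by rewrite ltnn add0n.
    move=> /andP[/insert_front_head[t ->]] /=; rewrite ltnn add0n => /eqP ->.
    by rewrite exprD mulrC.
  apply: eq_big => s.
    case: (boolP (s \in _)) => //= /insert_in_head[t ->] /=.
    by rewrite cM add1n eqSS.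
  move=> /andP[/insert_in_head[t ->]] /=; rewrite cM add1n => /eqP ->.
  by rewrite exprD mulrC.
elim: u b => [|b' u IH] b uM.
  have H k e : S (insert_in [:: b] k) (des [:: b] + e) =
      x ^+ lmaj [:: b] * ins_gf (size (nil : seq nat) - des [:: b]) (des [:: b]) k e.
    rewrite /= ltnn /= /ins_gf; case: k => [|k] /=.
      rewrite /S big_cons big_nil /= ltnn; case: e => [|e]; last by rewrite mulr0.
      by rewrite !qbin0 !mulr1 addr0.
    rewrite /S big_nil; case: e => [|e].
      by rewrite subn0 add0n /= (@qbin_small _ _ k) // !mulr0.
    by rewrite (@qbin_small _ _ 0) // mulr0 mul0r if_same mulr0.
  move=> k e; split; first exact: H.
  by apply: front => //; case/andP: uM.
have H k e : S (insert_in [:: b, b' & u] k) (des [:: b, b' & u] + e) =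
      x ^+ lmaj [:: b, b' & u] *
      ins_gf (size (b' :: u) - des [:: b, b' & u]) (des [:: b, b' & u]) k e.
  have /andP[bM uM'] := uM.
  have {IH} IH := IH _ uM'.
  have nlt s : s \in insert_front (insert_in (b' :: u)) k ->
      exists t, s = M :: t /\ (head b s < b)%N = false.
    by move=> /insert_front_head[t ->]; exists t; split=> //=; lia.
  rewrite /S insert_in_cons2 big_map big_cat.
  have -> : \sum_(s <- insert_front (insert_in (b' :: u)) k |
        des (b :: s) == (des [:: b, b' & u] + e)%N) x ^+ lmaj (b :: s) =
      x ^+ (des [:: b, b' & u] + e) *
      S (insert_front (insert_in (b' :: u)) k) (des [:: b, b' & u] + e).
    rewrite /S big_distrr big_seq_cond [RHS]big_seq_cond /=.
    apply: eq_big => s.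
      by case: (boolP (s \in _)) => //= /nlt[t [_ ->]].
    by move=> /andP[/nlt[t [_ ->]]] /eqP ->; rewrite exprD mulrC.
  have -> : \sum_(s <- insert_in (b' :: u) k |
        des (b :: s) == (des [:: b, b' & u] + e)%N) x ^+ lmaj (b :: s) =
      x ^+ (des [:: b, b' & u] + e) *
      S (insert_in (b' :: u) k) (des (b' :: u) + e).
    rewrite /S big_distrr big_seq_cond [RHS]big_seq_cond.
    apply: eq_big => s.
      case: (boolP (s \in _)) => // /insert_in_head[t ->] /=.
      by rewrite -!addnA eqn_add2l.
    move=> /andP[/insert_in_head[t ->]] /=.
    by move=> /eqP E; rewrite exprD E mulrC.
  have le_des := des_lt_size b' u.
  have -> : lmaj [:: b, b' & u] = (lmaj (b' :: u) + des [:: b, b' & u])%N by [].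
  have -> : des [:: b, b' & u] = ((b' < b) + des (b' :: u))%N by [].
  have -> : size (b' :: u) = (size u).+1 by [].
  rewrite -[LHS]/(_ + _) (proj1 (IH k e)).
  move: IH le_des; set c := des (b' :: u); set l := lmaj _ => IH le_des.
  case: ltnP => bb'; rewrite ?add1n ?add0n.
    by rewrite addSn (proj2 (IH k e)) -!mulrDr mulrCA -addSn -ins_gf_desc subSS exprD mulrA.
  rewrite [x ^+ (l + c)]exprD -mulrA subSn //.
  case: e => [|e].
    (* With e = 0 no copy may enter the new gap: by [des_insert] it would create a descent. *)
    rewrite ins_gf_asc0 addn0 {1}/S big_seq_cond big_pred0 ?mulr0 ?add0r; first by rewrite mulrCA.
    move=> s; case: (boolP (s \in _)) => // sF /=.
    by apply: gtn_eqF; apply: (proj2 (des_insert k uM')).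
  by rewrite ins_gf_asc [in S _ _]addnS (proj2 (IH k e)) -mulrDr -mulrDr mulrCA.
by move=> k e; split; [exact: H | apply: front => //; case/andP: uM].
Qed.

End Insertion.

Lemma count_mem_cons_map (y b : nat) t (L : seq (seq nat)) :
  count_mem (y :: t) (map (cons b) L) = (y == b) * count_mem t L.
Proof.
rewrite count_map; case: eqVneq => [->|yb].
  by rewrite mul1n; apply: eq_count => s /=; rewrite eqseq_cons eqxx.
rewrite mul0n (eq_count (a2 := pred0)) ?count_pred0 // => s /=.
by rewrite eqseq_cons eq_sym (negPf yb).
Qed.

Arguments insert_in : simpl never.

(** A multiplicity equal to a truth value gives membership and absence of repetitions at once. The
    first letter of [s] decides which branch can produce it; the default in [last M s] excludes the
    empty word. *)
Lemma count_insert M s u k : u != [::] -> all (fun a => a < M) u ->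
  count_mem s (insert_front M (insert_in M u) k ++ insert_in M u k) =
  [&& all (fun a => a <= M) s, count_mem M s == k,
      [seq a <- s | a < M] == u & last M s != M].
Proof.
elim: s u k => [|y t IH] [|b u] k // _ uM.
  rewrite (count_memPn _) /= ?eqxx ?andbF // mem_cat negb_or.
  apply/andP; split; apply/negP.
    by move=> /insert_front_head[].
  by move=> /insert_in_head[].
have /andP[bM uM'] := uM.
rewrite count_cat; case: (eqVneq y M) => [->|yM].
  rewrite [X in _ + X](count_memPn _) ?addn0; last first.
    by apply/negP => /insert_in_head[t' [E]]; rewrite E ltnn in bM.
  rewrite /= eqxx leqnn ltnn /=; case: k => [|k] /=; first by rewrite andbF.
  by rewrite count_mem_cons_map eqxx mul1n IH // add1n eqSS.
rewrite (count_memPn _) ?add0n; last first.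
  by apply/negP => /insert_front_head[t' [E]]; rewrite E eqxx in yM.
rewrite /= (negPf yM) add0n; case: (eqVneq y b) => [->|yb]; last first.
  rewrite (count_memPn _); last first.
    by apply/negP => /insert_in_head[t' [E]]; rewrite E eqxx in yb.
  case: (ltngtP y M) yM => //= _ _.
  by rewrite eqseq_cons (negPf yb) !andbF.
rewrite bM (ltnW bM) /= eqseq_cons eqxx /=.
case: u => [|b' u] in uM uM' *; last first.
  rewrite insert_in_cons2 count_mem_cons_map eqxx mul1n IH //.
  by case: t {IH} => //=; rewrite !andbF.
case: t {IH} => [|y' t].
  by rewrite /= (ltn_eqF bM) !andbT; case: k => //=; rewrite eqxx.
rewrite (count_memPn _); last by case: k => [|k]; rewrite /insert_in ?inE // eqseq_cons eqxx.
(* If all conditions held, every letter after the single small one would be [M], including the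
   last. *)
case: and4P => // -[tM _ tM' /= /eqP[]].
have : last y' t \in y' :: t by exact: mem_last.
move: (last _ _) => z zt; apply/eqP.
rewrite eqn_leq (allP tM) //= leqNgt; apply/negP => zM.
have : z \in [seq a <- y' :: t | a < M] by rewrite mem_filter zM.
by rewrite (eqP tM').
Qed.

Lemma count_insert_in M s u k : u != [::] -> all (fun a => a < M) u ->
  count_mem s (insert_in M u k) =
  [&& all (fun a => a <= M) s, count_mem M s == k, [seq a <- s | a < M] == u,
      last M s != M & head M s != M].
Proof.
move=> u0 uM; have := count_insert s k u0 uM; rewrite count_cat.
case: s => [|y t]; first by rewrite /= eqxx !andbF => /eqP; rewrite addn_eq0 => /andP[_ /eqP].
case: (eqVneq y M) => yM.
  rewrite /= yM eqxx !andbF => _; apply/count_memPn; apply/negP.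
  case: u u0 uM => // b u _ /andP[bM _] /insert_in_head[t' [E _]].
  by rewrite E ltnn in bM.
rewrite andbT (count_memPn _) ?add0n //.
by apply/negP => /insert_front_head[t' [E]]; rewrite E eqxx in yM.
Qed.

Lemma count_mem_filter (T : eqType) (p : pred T) (L : seq T) y :
  count_mem y (filter p L) = p y * count_mem y L.
Proof.
rewrite count_filter; case: (boolP (p y)) => py.
  by rewrite mul1n; apply: eq_count => b /=; case: eqP => //= ->.
rewrite mul0n (eq_count (a2 := pred0)) ?count_pred0 // => b /=.
by case: eqP => //= ->; rewrite (negPf py).
Qed.

Lemma sum_eq_count (T : eqType) (L : seq T) y : \sum_(u <- L) (u == y) = count_mem y L.
Proof. by elim: L => [|u L IH]; rewrite ?big_nil // big_cons IH. Qed.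

Lemma size_sum_count a i (z : seq nat) : all (fun b => a <= b <= a + i) z ->
  size z = \sum_(a <= j < (a + i).+1) count_mem j z.
Proof.
elim: z => [|b z IH]; first by rewrite big1.
move=> /andP[bA /IH] zE; rewrite /= big_split /= -zE.
rewrite (bigD1_seq b) ?mem_index_iota ?iota_uniq //= eqxx big1 // => j.
by rewrite eq_sym => /negPf->.
Qed.

(** * Words starting and ending with their smallest letter *)

Section InsertionFamily.
Variables (a : nat) (alpha c : nat -> nat).

(** The values a+1, a+2, ... are inserted one after the other into a constant word, whose additional
    [a] closes the cyclic word; filtering by [des] at each stage prescribes the cyclic descents. *)
Fixpoint ins_family (i : nat) : seq (seq nat) :=
  if i is i'.+1 then
    [seq z <- flatten [seq insert_in (a + i) u (alpha (a + i)) | u <- ins_family i']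
    | des z == c (a + i)]
  else if c a == 0 then [:: nseq (alpha a).+1 a] else [::].

(* Here z = rcons w a, where w starts with its smallest letter a: the cyclic
   descents of w are then the descents of z, and z has one more a than w. *)
Definition in_family (i : nat) (z : seq nat) : bool :=
  [&& z != [::], head a z == a, last a z == a, all (fun b => a <= b <= a + i) z,
      count_mem a z == (alpha a).+1,
      all (fun j => count_mem j z == alpha j) (iota a.+1 i) &
      all (fun j => des (restrict j z) == c j) (iota a i.+1)].

Lemma des_nseq k b : des (nseq k b) = 0.
Proof. by elim: k => //= k ->; case: k => [|k] /=; rewrite ltnn. Qed.

Lemma lmaj_nseq k b : lmaj (nseq k b) = 0.
Proof. by elim: k => //= k ->; rewrite des_nseq; case: k => [|k] /=; rewrite ltnn. Qed.

Lemma restrict_id j z : all (fun b => b <= j) z -> restrict j z = z.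
Proof. by move/all_filterP. Qed.

Lemma restrict_restrict j k z : j <= k -> restrict j (restrict k z) = restrict j z.
Proof.
move=> jk; rewrite /restrict -filter_predI; apply: eq_filter => b /=.
by case: leqP => //= bj; rewrite (leq_trans bj).
Qed.

Lemma restrict_cons_le j h t : h <= j -> restrict j (h :: t) = h :: restrict j t.
Proof. by rewrite /restrict /= => ->. Qed.

Lemma last_restrict j b z : last b z <= j -> last b (restrict j z) = last b z.
Proof.
case: (lastP z) => // z' l; rewrite last_rcons => lj.
by rewrite /restrict filter_rcons lj last_rcons.
Qed.

(** Deleting the largest letter changes neither the smaller restrictions nor their contents, and
    both end letters survive because they differ from it. The conditions are those of
    [count_insert_in]. *)
Lemma in_familyS i z : in_family i.+1 z =
  [&& all (fun b => b <= a + i.+1) z, count_mem (a + i.+1) z == alpha (a + i.+1),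
     last (a + i.+1) z != a + i.+1, head (a + i.+1) z != a + i.+1,
     des z == c (a + i.+1) & in_family i (restrict (a + i) z)].
Proof.
have cE j : j <= a + i -> count_mem j (restrict (a + i) z) = count_mem j z.
  move=> ji; rewrite count_filter.
  by apply: eq_count => b /=; case: eqP => //= ->; lia.
have E1 : iota a.+1 i.+1 = iota a.+1 i ++ [:: a + i.+1].
  by rewrite -[i.+1]addn1 iotaD addSnnS addn1.
have E2 : iota a i.+2 = iota a i.+1 ++ [:: a + i.+1] by rewrite -[i.+2]addn1 iotaD.
rewrite /in_family E1 E2 !all_cat !all_seq1 cE ?leq_addr //.
rewrite [in RHS](@eq_in_all _ (fun j => count_mem j _ == _)
  (fun j => count_mem j z == alpha j)); last first.
  by move=> j; rewrite mem_iota => ji; rewrite cE //; lia.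
rewrite [in RHS](@eq_in_all _ (fun j => des _ == _)
  (fun j => des (restrict j z) == c j)); last first.
  by move=> j; rewrite mem_iota => ji; rewrite restrict_restrict //; lia.
case: z {cE} => [|h z]; first by rewrite /= eqxx !andbF.
set A1 := count_mem a _ == _; set A2 := all _ (iota a.+1 i).
set A3 := count_mem (a + i.+1) _ == _; set A4 := all _ (iota a i.+1).
rewrite [head a (h :: z)]/= [last a (h :: z)]/= [last (a + i.+1) (h :: z)]/=.
rewrite [head (a + i.+1) (h :: z)]/=.
apply/and5P/and5P.
  case=> _ /eqP ha /eqP lz zA; rewrite ha in lz zA *.
  move=> /and4P[-> /andP[-> ->] -> dz].
  have zM : all (fun b => b <= a + i.+1) (a :: z).
    by apply: sub_all zA => b /andP[].
  rewrite restrict_id // in dz; rewrite lz; split=> //; try lia.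
  rewrite dz restrict_cons_le ?leq_addr // /= eqxx last_restrict ?lz ?leq_addr //.
  rewrite eqxx leqnn andbT all_filter /=.
  apply/allP => b bz; apply/implyP => ->; rewrite andbT.
  by have /andP[] := allP zA b (mem_behead (s := a :: z) bz).
case=> zM -> lz hz /and5P[dz _].
have hi : h <= a + i by case/andP: zM; lia.
have li : last h z <= a + i by have /= := allP zM _ (mem_last h z); lia.
rewrite restrict_cons_le // [head _ _]/= => /eqP ha.
rewrite [last a _]/= last_restrict // => /eqP la /and4P[zA -> -> ->].
rewrite (restrict_id zM) dz la ha eqxx; split=> //.
apply/allP => b bz; have {}bz : b \in h :: z by rewrite ha.
have /= bM := allP zM b bz.
rewrite bM andbT leqNgt; apply/negP => ba.
have : b \in h :: restrict (a + i) z.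
  by rewrite -restrict_cons_le // mem_filter bz andbT; lia.
by move/(allP zA); lia.
Qed.

Lemma count_ins_family i z : count_mem z (ins_family i) = in_family i z.
Proof.
elim: i z => [|i IH] z.
  rewrite /= /in_family /= !addn0 !andbT.
  have -> : all (fun b => a <= b <= a) z = all (pred1 a) z.
    by apply: eq_all => b /=; rewrite eqn_leq andbC.
  case: (boolP (all (pred1 a) z)) => [/all_pred1P zE|za]; last first.
    rewrite !andbF; case: eqP => //= _; rewrite addn0.
    apply/eqP; rewrite eqb0; apply: contraNneq za => <-; rewrite /= eqxx.
    by apply/all_pred1P; rewrite size_nseq.
  have -> : (count_mem a z == (alpha a).+1) = (nseq (alpha a).+1 a == z).
    rewrite zE count_nseq /= eqxx mul1n; apply/eqP/eqP => [->//|].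
    by move=> /(congr1 size) /=; rewrite !size_nseq => <-.
  case: (eqVneq (nseq (alpha a).+1 a) z) => [<-|nz]; last first.
    by rewrite !andbF; case: eqP => //= _; rewrite (negPf nz).
  have := restrict_id (j := a) (z := nseq (alpha a).+1 a).
  rewrite all_nseq leqnn orbT => -> //; rewrite des_nseq eq_sym /= eqxx.
  have -> : last a (nseq (alpha a) a) = a by elim: (alpha a) => //=.
  by rewrite eqxx; case: eqP => //=; rewrite eqxx.
rewrite in_familyS /= count_mem_filter count_flatten -map_comp sumnE big_map.
set M := a + i.+1.
(* The word [z] can arise only from [u = restrict (a + i) z]. *)
rewrite (eq_big_seq (fun u => (u == restrict (a + i) z) *
   [&& all (fun b => b <= M) z, count_mem M z == alpha M, last M z != M & head M z != M])); last first.
  move=> u; rewrite -(has_pred1) has_count IH lt0b => /and5P[u0 _ _ uM _].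
  rewrite /= count_insert_in //; last by apply: sub_all uM => b /andP[_]; rewrite /M; lia.
  have -> : [seq b <- z | b < M] = restrict (a + i) z.
    by apply: eq_filter => b; rewrite /M addnS.
  rewrite (eq_sym (restrict _ _) u) mulnb; congr nat_of_bool.
  by case: (u == _); rewrite /= ?andbF.
rewrite -big_distrl /= sum_eq_count IH !mulnb; congr nat_of_bool.
rewrite -/M; case: (des z == _); rewrite ?andbF //=.
by case: (in_family _ _); rewrite ?andbF ?andbT.
Qed.

(** For [z] in the family this is the length of the cyclic word, hence the number of gaps between
    neighbouring letters of [z]. *)
Definition content_sum i := \sum_(a <= j < (a + i).+1) alpha j.

Lemma in_family_des i z : in_family i z -> des z = c (a + i).
Proof.
case/and5P => _ _ _ zA /and3P[_ _ /allP/(_ (a + i))]; rewrite mem_iota.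
rewrite restrict_id => [H|]; first by apply/eqP/H; lia.
by apply: sub_all zA => b /andP[].
Qed.

Lemma in_family_size i z : in_family i z -> size z = (content_sum i).+1.
Proof.
case/and5P => _ _ _ zA /and3P[/eqP ca cj _].
rewrite (size_sum_count zA) /content_sum !(big_ltn (_ : a < (a + i).+1)) ?ltnS ?leq_addr // ca addSn.
congr (_ + _).+1; apply: eq_big_seq => j; rewrite mem_index_iota => ji.
by apply/eqP/(allP cj); rewrite mem_iota; lia.
Qed.

Lemma ins_family_uniq i : uniq (ins_family i).
Proof.
by apply/count_mem_uniq => z; rewrite -has_pred1 has_count count_ins_family lt0b.
Qed.

Lemma mem_ins_family i z : (z \in ins_family i) = in_family i z.
Proof. by rewrite -has_pred1 has_count count_ins_family lt0b. Qed.

Hypothesis c_mono : {homo c : i j / i <= j}.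
Variables (R : comNzRingType) (x : R).
Local Open Scope ring_scope.

Definition family_gf i : R := \sum_(z <- ins_family i) x ^+ lmaj z.

Lemma family_gf0 : family_gf 0 = (c a == 0%N)%:R.
Proof.
by rewrite /family_gf /=; case: eqP; rewrite ?big_nil // big_seq1 (lmaj_nseq _.+1).
Qed.

(** The factor in [insert_gf] depends on a word only through its length and descent number, which
    are constant on the family; [c_mono] makes the truncated difference exact. *)
Lemma family_gfS i (M := (a + i.+1)%N) : family_gf i.+1 =
  family_gf i *
  ins_gf x (content_sum i - c (a + i)) (c (a + i)) (alpha M) (c M - c (a + i)).
Proof.
rewrite /family_gf /= big_filter big_flatten /= big_map big_distrl /=.
apply: eq_big_seq => u; rewrite mem_ins_family => uF.
have uD := in_family_des uF; have := in_family_size uF.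
case/and5P: uF => u0 _ _ uM _.
have {}uM : all (fun b => (b < M)%N) u.
  by apply: sub_all uM => b /andP[_]; rewrite /M; lia.
case: u u0 uD uM => // b u _ uD uM [uS].
rewrite -uS -uD -(proj1 (insert_gf x uM _ _)) uD subnKC //.
by apply: c_mono; rewrite /M; lia.
Qed.

End InsertionFamily.

(** * Evaluation at a root of unity *)

Section RootEvaluation.
Variables (F : fieldType) (x : F) (d : nat).
Local Open Scope ring_scope.
Hypothesis x_prim : d.-primitive_root x.

Let d_gt0 : (0 < d)%N. Proof. exact: prim_order_gt0 x_prim. Qed.

Lemma qbin_dvd A j : (d %| A)%N ->
  qbin x A j = if (d %| j)%N then 'C(A %/ d, j %/ d)%:R else 0.
Proof.
move=> /dvdnP[A' ->]; rewrite mulnK //.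
have := @qbin_lucas _ _ _ x_prim A' 0 (j %/ d) (j %% d) d_gt0 (ltn_pmod _ d_gt0).
rewrite addn0 -divn_eq => ->; rewrite /dvdn.
by case: (j %% d)%N => [|s]; rewrite ?qbin0 ?mulr1 // qbin_small // mulr0.
Qed.

(** If [d] does not divide [j], the last base-d digit of C + j - 1 is one less than that of [j], so
    the Lucas factor on the last digits vanishes. *)
Lemma qbin_pred_dvd C j : (d %| C)%N ->
  qbin x (C + j).-1 j = if (d %| j)%N then 'C((C %/ d + j %/ d).-1, j %/ d)%:R else 0.
Proof.
move=> /dvdnP[C' ->]; rewrite mulnK //.
case: ifPn => [/dvdnP[j' ->]|dj].
  rewrite mulnK // -mulnDl; case: (posnP (C' + j')%N) => [C0|C0].
    have [-> ->] : C' = 0%N /\ j' = 0%N by lia.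
    by rewrite !qbin0 bin0.
  have -> : (((C' + j') * d).-1 = (C' + j').-1 * d + d.-1)%N by nia.
  rewrite -[(j' * d)%N]addn0 qbin_lucas // ?qbin0 ?mulr1 //; lia.
have s0 : (0 < j %% d)%N by rewrite lt0n.
have sd := ltn_pmod j d_gt0.
have -> : ((C' * d + j).-1 = (C' + j %/ d) * d + (j %% d).-1)%N.
  rewrite [in LHS](divn_eq j d) mulnDl addnA; move: s0.
  by case: (j %% d)%N => // s _; rewrite addnS.
rewrite [in qbin _ _ j](divn_eq j d) qbin_lucas //; last by lia.
by rewrite -divn_eq (@qbin_small _ _ (j %% d).-1) ?mulr0 //; lia.
Qed.

(** Only the new totals are assumed divisible. As c + k = (c + e) + (k - e), the second q-binomial
    forces [d] to divide k - e, hence N - c, and then the first one forces [d] to divide [e]. *)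
Lemma ins_gf_root N c k e : (d %| N + k)%N -> (d %| c + e)%N ->
  ins_gf x (N - c) c k e =
  if (d %| k)%N && (d %| e)%N then
    ins_gf 1 (N %/ d - c %/ d) (c %/ d) (k %/ d) (e %/ d) else 0.
Proof.
move=> dNk dce; rewrite /ins_gf; case: (ltnP k e) => ke.
  by case: ifPn => // /andP[dk de]; rewrite ltn_divRL // divnK // ke.
have -> : (c + k = c + e + (k - e))%N by lia.
rewrite qbin_pred_dvd //.
case: (boolP (d %| k - e)%N) => dj; last first.
  rewrite mulr0; case: ifPn => // /andP[dk de].
  by rewrite dvdn_sub in dj.
have dA : (d %| N - c)%N.
  case: (leqP c N) => cN; last by rewrite (_ : N - c = 0)%N ?dvdn0 //; lia.
  rewrite -(dvdn_addl _ dj); have -> : (N - c + (k - e) = N + k - (c + e))%N by lia.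
  exact: dvdn_sub.
rewrite (qbin_dvd _ dA); case: (boolP (d %| e)%N) => de; last first.
  by rewrite andbF mulr0 mul0r.
have dk : (d %| k)%N by rewrite -(subnK ke) dvdn_add.
have dc : (d %| c)%N by rewrite -(dvdn_addl _ de).
have dN : (d %| N)%N by rewrite -(dvdn_addl _ dk).
rewrite dk /= ltnNge leq_div2r //=.
rewrite expr1n mul1r !qbin1 divnBl // (divnBl (m := k)) // divnDl //.
rewrite dc de !subn0.
have -> : (c %/ d + e %/ d + (k %/ d - e %/ d) = c %/ d + k %/ d)%N.
  by rewrite -addnA subnKC // leq_div2r.
have /dvdnP[m ->] : (d %| (c + e) * e + k)%N by rewrite dvdn_add // dvdn_mulr.
by rewrite mulnC exprM (prim_expr_order x_prim) expr1n mul1r.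
Qed.

Variables (a : nat) (alpha c : nat -> nat).
Hypothesis c_mono : {homo c : i j / (i <= j)%N}.

Local Notation alphad := (fun j => (alpha j %/ d)%N).
Local Notation cd := (fun j => (c j %/ d)%N).

(** Divisibility descends: a nonzero last factor forces [d] to divide the new entries, hence also
    the totals of the level below. *)
Lemma family_gf_root i : (d %| content_sum a alpha i)%N -> (d %| c (a + i))%N ->
  family_gf a alpha c x i =
  if all (fun j => (d %| alpha j)%N && (d %| c j)%N) (iota a i.+1)
  then (size (ins_family a alphad cd i))%:R else 0.
Proof.
have c_mono' : {homo cd : j k / (j <= k)%N}.
  by move=> j k /c_mono jk; exact: leq_div2r.
(* At q = 1 the generating function counts, so the count obeys the same recursion. *)
have sizeE j : (size (ins_family a alphad cd j))%:R = family_gf a alphad cd 1 j :> F.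
  rewrite /family_gf; under eq_bigr do rewrite expr1n.
  by rewrite big_const_seq count_predT iter_addr addr0.
rewrite sizeE.
elim: i => [|i IH].
  rewrite /content_sum addn0 big_nat1 => da dc; rewrite /= da dc /= !family_gf0.
  by congr (_ %:R); rewrite -[in RHS](eqn_pmul2r d_gt0) divnK // mul0n.
have csS (al : nat -> nat) : content_sum a al i.+1 = (content_sum a al i + al (a + i.+1))%N.
  by rewrite /content_sum addnS big_nat_recr //= -addnS leq_addr.
rewrite csS => dN dc; have cc : (c (a + i) <= c (a + i.+1))%N by apply: c_mono; lia.
rewrite !family_gfS // ins_gf_root // ?subnKC //.
have -> : iota a i.+2 = rcons (iota a i.+1) (a + i.+1)%N.
  by rewrite -[i.+2]addn1 iotaD cats1.
rewrite all_rcons dc andbT.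
case: (boolP (d %| _)%N) => dk; last by rewrite /= mulr0.
rewrite !andTb.
case: (boolP (d %| _)%N) => de.
  have dci : (d %| c (a + i))%N.
    by rewrite -(dvdn_addl _ de) subnKC.
  have dNi : (d %| content_sum a alpha i)%N by rewrite -(dvdn_addl _ dk).
  rewrite IH //.
  case: ifP => [H|]; last by rewrite mul0r.
  congr (_ * ins_gf _ (_ - _) _ _ _); last by rewrite divnBl // dci subn0.
  have -> : content_sum a alpha i = (content_sum a alphad i * d)%N.
    rewrite /content_sum big_distrl; apply: eq_big_seq => j.
    rewrite mem_index_iota -addnS -mem_iota => /(allP H)/andP[dj _].
    by rewrite /= divnK.
  by rewrite mulnK.
rewrite mulr0; case: ifP => // /allP/(_ (a + i)%N); rewrite mem_iota leq_addr addnS leqnn.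
by move=> /(_ isT)/andP[_ dci]; rewrite dvdn_sub in de.
Qed.
End RootEvaluation.

(** * Cyclic descents, rotations and powers of words *)

Lemma des_sum z : des z = \sum_(i < (size z).-1) (nth 0 z i.+1 < nth 0 z i).
Proof.
elim: z => [|b [|b' z] IH]; rewrite ?big_ord0 //=; first by rewrite ltnn.
by rewrite big_ord_recl /=; congr (_ + _); exact: IH.
Qed.

Lemma lmaj_maj z : lmaj z = maj z.
Proof.
elim: z => [|b z IH]; first by rewrite /maj big_geq.
rewrite [lmaj _]/= -/(des (b :: z)) IH des_sum /maj [size _]/=.
rewrite (big_addn 0 (size z).+1 1) subn1 [_.+1.-1]/=.
rewrite [RHS]big_split /=; congr (_ + _); last first.
  rewrite [RHS]big_mkcond big_mkord.
  by apply: eq_bigr => i _; rewrite addn1 /=; case: ifP.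
case: z {IH} => [|b' z]; first by rewrite !big_geq.
rewrite [RHS]big_mkcond [RHS]big_ltn //= if_same add0n -big_mkcond.
by rewrite big_nat_cond [RHS]big_nat_cond; apply: eq_bigl => i; rewrite addn1; case: i.
Qed.

Lemma des_rcons b s y : des (rcons (b :: s) y) = des (b :: s) + (y < last b s).
Proof.
elim: s b => [|b' s IH] b /=; first by rewrite ltnn; lia.
by have /= -> := IH b'; rewrite addnA.
Qed.

Lemma lmaj_rcons b s y :
  lmaj (rcons (b :: s) y) = lmaj (b :: s) + (size s).+1 * (y < last b s).
Proof.
elim: s b => [|b' s IH] b; first by rewrite /= !ltnn; lia.
have -> : lmaj (rcons [:: b, b' & s] y) =
    lmaj (rcons (b' :: s) y) + des (rcons [:: b, b' & s] y) by [].
have -> : lmaj [:: b, b' & s] = lmaj (b' :: s) + des [:: b, b' & s] by [].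
rewrite IH des_rcons [last b _]/= [size (b' :: s)]/=.
by case: (y < last b' s); lia.
Qed.

Lemma cdes_des b s : cdes (b :: s) = des (rcons (b :: s) b).
Proof.
rewrite des_sum size_rcons /cdes; apply: eq_bigr => i _.
have iS := ltn_ord i; rewrite !nth_rcons iS.
case: (ltngtP i.+1 (size (b :: s))) => [lt|gt|eq]; first by rewrite modn_small.
  by move: iS gt => /=; lia.
by rewrite eq modnn.
Qed.

(** Both sides are the major index of [rcons w b]: appending [b] may create a descent at position n,
    while prepending [b] to [rot 1 w] adds the descent number of the result, which is [cdes w]. *)
Lemma maj_rot1 b s (w := b :: s) :
  maj w + size w * (b < last b s) = maj (rot 1 w) + cdes w.
Proof.
by rewrite -!lmaj_maj -lmaj_rcons /w cdes_des /rot /= drop0 take0 cats1.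
Qed.

Lemma cdes_rot1 w : cdes (rot 1 w) = cdes w.
Proof.
case: w => // b [|b' s] //.
rewrite rot1_cons rcons_cons !cdes_des des_rcons last_rcons.
by rewrite [in RHS]/= addnC.
Qed.

Lemma restrict_rot1 j w :
  restrict j (rot 1 w) = restrict j w \/ restrict j (rot 1 w) = rot 1 (restrict j w).
Proof.
case: w => [|b s]; first by left.
rewrite rot1_cons /restrict filter_rcons /=; case: ifP => _; last by left.
by right; rewrite rot1_cons.
Qed.

Lemma cdes_restrict_rot k j w : cdes (restrict j (rot k w)) = cdes (restrict j w).
Proof.
have H v : cdes (restrict j (rot 1 v)) = cdes (restrict j v).
  by case: (restrict_rot1 j v) => ->; rewrite ?cdes_rot1.
case: (leqP k (size w)) => [|kw]; last by rewrite rot_oversize // ltnW.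
by elim: k => [|k IH] kw; rewrite ?rot0 // rotS // H IH // ltnW.
Qed.

(** Splitting off the prefix v of length [p] leaves u with uv = vu, so a nonempty u begins with v
    and is again fixed by the rotation. *)
Lemma rot_fixed_wpow p f w : size w = f * p -> rot p w = w -> w = wpow (take p w) f.
Proof.
elim: f w => [|f IH] w; first by move/size0nil->.
move=> sw rw; have pw : p <= size w by rewrite sw mulSn leq_addr.
have sv : size (take p w) = p by rewrite size_takel.
set v := take p w in sv *; set u := drop p w.
have wE : w = v ++ u by rewrite cat_take_drop.
have uv : u ++ v = v ++ u by rewrite -wE -[in RHS]rw.
have su : size u = f * p by rewrite size_drop sw mulSn addKn.
suff uE : u = wpow v f by rewrite wE uE.
case: f => [|f] in IH sw su *; first by move: su => /size0nil ->.
have tu : take p u = v.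
  have := congr1 (take p) uv; rewrite (take_size_cat _ sv) takel_cat //.
  by rewrite su mulSn leq_addr.
rewrite -tu; apply: IH => //; rewrite /rot tu.
have := congr1 (drop p) uv; rewrite (drop_size_cat _ sv) => E.
by rewrite -[RHS]E -[in RHS](cat_take_drop p u) tu -catA (drop_size_cat _ sv).
Qed.

Lemma wpowS v f : wpow v f.+1 = v ++ wpow v f.
Proof. by []. Qed.

Lemma wpowSr v f : wpow v f.+1 = wpow v f ++ v.
Proof. by elim: f => [|f IH]; [rewrite /wpow /= cats0 | rewrite wpowS {1}IH catA]. Qed.

Lemma rot_wpow v f : rot (size v) (wpow v f) = wpow v f.
Proof. by case: f => [|f]; rewrite ?wpowS ?rot_size_cat -?wpowSr // /rot /= /wpow /=. Qed.

Lemma count_wpow p v f : count p (wpow v f) = f * count p v.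
Proof. by elim: f => [|f IH] //; rewrite wpowS count_cat IH mulSn. Qed.

Lemma restrict_wpow j v f : restrict j (wpow v f) = wpow (restrict j v) f.
Proof. by elim: f => [|f IH] //; rewrite !wpowS /restrict filter_cat -IH. Qed.

Lemma des_cat b s t : des ((b :: s) ++ t) = des (b :: s) + des (last b s :: t).
Proof.
elim: s b => [|b' s IH] b; first by rewrite [in RHS]/= ltnn.
by have /= -> := IH b'; rewrite addnA.
Qed.

(** Once the power is closed by its first letter, every block is followed by that letter, so each
    contributes [cdes v]. *)
Lemma cdes_wpow v f : cdes (wpow v f) = f * cdes v.
Proof.
case: v => [|b s].
  by have -> : wpow [::] f = [::]; [elim: f | rewrite /cdes !big_ord0 muln0].
case: f => [|f]; first by rewrite /cdes big_ord0.
rewrite [wpow _ _]wpowS [_ ++ _]/= cdes_des.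
rewrite -[b :: _]/((b :: s) ++ wpow (b :: s) f) -wpowS.
elim: f.+1 => [|g IH]; first by rewrite /= ltnn.
rewrite wpowS rcons_cat des_cat mulSn -IH.
have [t ->] : exists t, rcons (wpow (b :: s) g) b = b :: t.
  by case: (g) => [|g']; [exists [::] | rewrite wpowS /=; eexists].
by rewrite cdes_des des_rcons -addnA.
Qed.

(** * The sum of flex over a necklace *)

(** Unlike [rot k], which is the identity beyond the length, the iterates add for all exponents. *)
Local Notation shift k w := (iter k (rot 1) w).

Lemma size_shift k (w : seq nat) : size (shift k w) = size w.
Proof. by elim: k => //= k; rewrite size_rot. Qed.

Lemma shift_rot k (w : seq nat) : k <= size w -> shift k w = rot k w.
Proof. by elim: k => [|k IH] kw; rewrite ?rot0 // iterS IH 1?ltnW // -rotS. Qed.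

Lemma shift_size (w : seq nat) : shift (size w) w = w.
Proof. by rewrite shift_rot // rot_size. Qed.

Lemma shift_inj k : injective (fun w : seq nat => shift k w).
Proof. by elim: k => [|k IH] u v //= /rot_inj /IH. Qed.

Lemma shift_mul k m (w : seq nat) : shift k w = w -> shift (m * k) w = w.
Proof. by move=> kw; elim: m => // m IH; rewrite mulSn iterD IH. Qed.

Lemma exists_period (w : seq nat) : exists p, (0 < p) && (shift p w == w).
Proof.
exists (size w).-1.+1; rewrite /= -iterS.
by case: w => // b s; rewrite -[_.-1.+1]/(size (b :: s)) shift_size.
Qed.

Definition period w := ex_minn (exists_period w).

Lemma period_gt0 w : 0 < period w.
Proof. by rewrite /period; case: ex_minnP => p /andP[]. Qed.

Lemma shift_period w : shift (period w) w = w.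
Proof. by rewrite /period; case: ex_minnP => p /andP[_ /eqP]. Qed.

Lemma period_min w k : 0 < k -> shift k w = w -> period w <= k.
Proof.
by move=> k0 /eqP kw; rewrite /period; case: ex_minnP => p _; apply; rewrite k0.
Qed.

Lemma period_dvd w k : (period w %| k) = (shift k w == w).
Proof.
rewrite {2}(divn_eq k (period w)) addnC iterD shift_mul ?shift_period // /dvdn.
have := ltn_pmod k (period_gt0 w); move: (k %% _) => j jp.
case: (posnP j) => [->|j0]; first by rewrite !eqxx.
apply/esym/negbTE/negP => /eqP jw.
by have := period_min j0 jw; rewrite leqNgt jp.
Qed.

Lemma period_dvd_size w : period w %| size w.
Proof. by rewrite period_dvd shift_size. Qed.

Lemma period_shift k w : period (shift k w) = period w.
Proof.
have E j : (period (shift k w) %| j) = (period w %| j).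
  by rewrite !period_dvd -iterD addnC iterD (inj_eq (@shift_inj k)).
by apply/eqP; rewrite eqn_dvd E dvdnn -E dvdnn.
Qed.

(** By [rot_fixed_wpow], [w] is a power of its prefix of period length; conversely, if w = v^f,
    shifting by the length of v fixes [w], so the period divides this length. *)
Lemma freq_period w : 0 < size w -> freq w = size w %/ period w.
Proof.
move=> w0; have [[v wE] fmax] := freqP w0.
have szE : size w = freq w * size v by rewrite {1}wE size_wpow.
have p0 := period_gt0 w; have pw := dvdn_leq w0 (period_dvd_size w).
apply/eqP; rewrite eqn_leq; apply/andP; split; last first.
  apply: (fmax _ (take (period w) w)); apply: rot_fixed_wpow.
    by rewrite divnK // period_dvd_size.
  by rewrite -shift_rot // shift_period.
have v0 : 0 < size v by move: w0; rewrite szE muln_gt0 => /andP[].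
have : period w %| size v.
  rewrite period_dvd shift_rot; last first.
    by rewrite szE leq_pmull //; move: w0; rewrite szE muln_gt0 => /andP[].
  by rewrite wE rot_wpow.
by move=> /(dvdn_leq v0) pv; rewrite leq_divRL // [X in _ <= X]szE leq_mul.
Qed.

Lemma freq_mul_period w : 0 < size w -> freq w * period w = size w.
Proof. by move=> w0; rewrite freq_period // divnK // period_dvd_size. Qed.

Lemma rotr_shiftK k (w : seq nat) : iter k (rotr 1) (shift k w) = w.
Proof. by elim: k => //= k IH; rewrite -iterS iterSr rotK. Qed.

Lemma shift_rotrK k (w : seq nat) : shift k (iter k (rotr 1) w) = w.
Proof. by elim: k => //= k IH; rewrite -iterS iterSr rotrK. Qed.

Lemma mem_necklace w u : 0 < size w ->
  reflect (exists k, u = shift k w) (u \in necklace w).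
Proof.
(* As n rotations are the identity, k rotations in one direction are (n - 1)k in the other. *)
move=> w0; have E k : size w * k = (size w).-1 * k + k by case: (size w) w0 => //= n _; lia.
apply: (iffP (necklaceP w u)) => -[k ->]; exists ((size w).-1 * k).
  by apply: (@shift_inj k); rewrite shift_rotrK -iterD addnC -E mulnC shift_mul ?shift_size.
by rewrite -[LHS](rotr_shiftK ((size w).-1 * k)) -iterD -E [size w * k]mulnC shift_mul ?shift_size.
Qed.

Definition sorted_necklace (w : seq nat) : seq (seq nat) :=
  sort (fun u v : seqlexi nat => (u <= v)%O) (necklace w).

Lemma sorted_necklace_shift k w : 0 < size w ->
  sorted_necklace (shift k w) = sorted_necklace w.
Proof.
move=> w0; apply/perm_sortP.
- by move=> u v; apply: le_total.
- by move=> u v t; apply: le_trans.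
- by move=> u v; apply: le_anti.
apply: uniq_perm; rewrite ?undup_uniq // => u.
apply/mem_necklace/mem_necklace; rewrite ?size_shift // => -[j ->].
  by exists (j + k); rewrite iterD.
exists (j + (size w).-1 * k); rewrite -iterD -addnA -mulSnr prednK //.
by rewrite iterD [_ * k]mulnC shift_mul ?shift_size.
Qed.

Lemma perm_sorted_necklace w : 0 < size w ->
  perm_eq (sorted_necklace w) [seq shift k w | k <- iota 0 (period w)].
Proof.
move=> w0; rewrite perm_sort; apply: uniq_perm; rewrite ?undup_uniq //.
  rewrite map_inj_in_uniq ?iota_uniq // => i j; rewrite !mem_iota !add0n /=.
  wlog ij : i j / i <= j => [H ip jp E|].
    by case: (leqP i j) => ij; [exact: H | apply/esym/H => //; exact: ltnW].
  move=> ip jp; rewrite -(subnK ij) addnC iterD => /shift_inj/esym/eqP.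
  rewrite -period_dvd => /dvdnP[[|m]]; first by rewrite mul0n => ->; rewrite addn0.
  by have := period_gt0 w; nia.
move=> u; apply/mem_necklace/mapP => // -[k].
  move=> ->; exists (k %% period w); first by rewrite mem_iota ltn_pmod ?period_gt0.
  by rewrite {1}(divn_eq k (period w)) addnC iterD shift_mul ?shift_period.
by move=> _ ->; exists k.
Qed.

Section OrbitSum.
Variables (F : fieldType) (x : F) (d : nat).
Local Open Scope ring_scope.
Hypothesis x_prim : d.-primitive_root x.

Lemma sum_periodic (g : nat -> F) p f :
  (forall k, g (p + k)%N = g k) ->
  \sum_(0 <= k < f * p) g k = (\sum_(0 <= k < p) g k) *+ f.
Proof.
move=> gp; elim: f => [|f IH]; first by rewrite big_geq.
rewrite mulSn (big_cat_nat (n := p)) ?leq_addr //= mulrS; congr (_ + _).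
rewrite -{1}[p]add0n big_addn addKn -IH.
by apply: eq_bigr => k _; rewrite addnC gp.
Qed.

Lemma orbit_flex_sum w (n := size w) : (0 < n)%N -> (d %| n)%N ->
  \sum_(0 <= k < n) x ^+ flex (shift k w) =
  ((rot (n %/ d) w == w) * n)%:R.
Proof.
move=> n0 dn; have fp := freq_mul_period n0; rewrite -/n in fp.
have p0 := period_gt0 w.
pose g (u : seq nat) := x ^+ (freq w * index u (sorted_necklace w)).
rewrite (eq_bigr (fun k => g (shift k w))); last first.
  move=> k _; rewrite /flex /lex -/(sorted_necklace _) sorted_necklace_shift //.
  by rewrite freq_period ?size_shift // period_shift -freq_period.
rewrite -{1}fp sum_periodic; last by move=> k; rewrite addnC iterD shift_period.
rewrite -(big_map (fun k => shift k w) xpredT g) /index_iota subn0.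
rewrite -(perm_big _ (perm_sorted_necklace n0)) /=.
set S := sorted_necklace w.
have sS : size S = period w.
  by rewrite (perm_size (perm_sorted_necklace n0)) size_map size_iota.
have uS : uniq S by rewrite sort_uniq undup_uniq.
rewrite (big_nth [::]) sS.
(* The word at place t of the sorted necklace has [lex] equal to t, so the sum is geometric with
   ratio [x ^+ freq w]. *)
rewrite (eq_big_nat _ _ (F2 := fun t => (x ^+ freq w) ^+ t)); last first.
  by move=> t /= tp; rewrite /g index_uniq ?sS // exprM.
have -> : (rot (n %/ d) w == w) = (d %| freq w)%N.
  rewrite -shift_rot ?leq_div // -period_dvd; apply/idP/idP => /dvdnP[m mE].
    apply/dvdnP; exists m; have /eqP := divnK dn.
    rewrite mE -[X in _ == X]fp mulnAC eqn_pmul2r // => /eqP <-; exact: erefl.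
  apply/dvdnP; exists m; rewrite -fp mE -mulnA [(d * _)%N]mulnC mulnA mulnK //.
  exact: prim_order_gt0 x_prim.
rewrite (prim_order_dvd x_prim); case: eqP => [->|/eqP f1].
  under eq_bigr do rewrite expr1n.
  by rewrite sumr_const_nat subn0 -mulrnA mul1n -fp mulnC.
rewrite mul0n -[RHS](mul0rn _ (freq w)); congr (_ *+ _).
(* Multiplied by the ratio minus 1, the geometric sum becomes x^n - 1 = 0. *)
apply: (mulfI (x := x ^+ freq w - 1)); first by rewrite subr_eq0.
rewrite mulr0 big_mkord -subrX1 -exprM fp.
by apply/eqP; rewrite subr_eq0 -(prim_order_dvd x_prim).
Qed.

End OrbitSum.

(** * The words with given content and cyclic descent type *)

(** The cyclic form of [in_family], before the first letter is repeated at the end. The default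
    [a.+1] makes the empty word fail. *)
Definition starts_at (a i : nat) (al cc : nat -> nat) (v : seq nat) : bool :=
  [&& head a.+1 v == a, all (fun b => a <= b <= a + i) v &
    all (fun j => (count_mem j v == al j) && (cdes (restrict j v) == cc j)) (iota a i.+1)].

Lemma in_family_rcons a i al cc v : v != [::] ->
  in_family a al cc i (rcons v a) = starts_at a i al cc v.
Proof.
case: v => // b s _; rewrite /in_family /starts_at last_rcons eqxx all_rcons leqnn leq_addr.
rewrite [head _ _]/= [head _ (b :: s)]/= [_ != _]/= !andTb.
case: eqP => [->|] //; rewrite !andTb; case: (all _ _) => //; rewrite !andTb.
have cE j : count_mem j (rcons (a :: s) a) = count_mem j (a :: s) + (a == j).
  by rewrite -cats1 count_cat /= addn0.
have dE j : a <= j -> des (restrict j (rcons (a :: s) a)) = cdes (restrict j (a :: s)).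
  by move=> aj; rewrite /restrict filter_rcons aj /= aj cdes_des.
rewrite (all_predI (fun j => _ == al j)) cE eqxx addn1 eqSS andbA; congr (_ && _).
  rewrite [in RHS]/= -/(count_mem a (a :: s)); congr (_ && _).
  apply: eq_in_all => j; rewrite mem_iota => ji; rewrite cE.
  by case/andP: ji => /ltn_eqF aj _; rewrite aj addn0 /= aj.
by apply: eq_in_all => j; rewrite mem_iota => ji; rewrite dE //; lia.
Qed.

(** Here [0 < al a] excludes the word [[:: a]], which would come from the empty word. *)
Lemma perm_family a i al cc L : 0 < al a -> uniq L ->
  (forall v, (v \in L) = starts_at a i al cc v) ->
  perm_eq (ins_family a al cc i) [seq rcons v a | v <- L].
Proof.
move=> al0 uL LE; apply: uniq_perm; first exact: ins_family_uniq.
  by rewrite map_inj_uniq // => u v /rcons_inj[].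
move=> z; rewrite mem_ins_family; apply/idP/mapP; last first.
  move=> [v + ->]; rewrite LE => vS; rewrite in_family_rcons //.
  by apply: contraTneq vS => ->; rewrite /starts_at /= gtn_eqF.
case: (lastP z) => // v b; move=> H; have := H; case/and5P=> _ _ + _ /andP[].
rewrite last_rcons => /eqP ba; rewrite {}ba in H *.
case: (eqVneq v [::]) => [->|v0]; first by rewrite /= eqxx; move: al0; lia.
by move=> _ _; exists v => //; rewrite LE -in_family_rcons.
Qed.

Lemma head_wpow b v f : 0 < f -> head b (wpow v f) = head b v.
Proof.
case: f => // f _; case: v => [|y s] //=.
by elim: f => //= f; rewrite wpowS.
Qed.

Lemma all_wpow p v f : 0 < f -> all p (wpow v f) = all p v.
Proof.
case: f => // f _; elim: f => [|f IH]; first by rewrite /wpow /= cats0.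
by rewrite wpowS all_cat IH andbb.
Qed.

Lemma starts_at_wpow a i al cc d v : 0 < d ->
  starts_at a i al cc (wpow v d) =
  all (fun j => (d %| al j) && (d %| cc j)) (iota a i.+1) &&
  starts_at a i (fun j => al j %/ d) (fun j => cc j %/ d) v.
Proof.
move=> d0; rewrite /starts_at head_wpow // all_wpow // [RHS]andbCA; congr (_ && _).
rewrite [RHS]andbCA -all_predI; congr (_ && _); apply: eq_all => j /=.
have E k m : (d * k == m) = (d %| m) && (k == m %/ d).
  apply/eqP/andP => [<-|[/divnK <- /eqP ->]]; last by rewrite mulnK // mulnC.
  by rewrite dvdn_mulr // mulKn.
by rewrite count_wpow restrict_wpow cdes_wpow !E andbACA.
Qed.

(* The class is described relatively to one of its members [w0], which makes all
   contents and cyclic descent numbers of restrictions functions of [w0]. *)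
Section WordClass.
Variables (w0 : seq nat) (a i : nat) (Wl : seq (seq nat)).
Local Notation c := (fun j => cdes (restrict j w0)).
Local Notation al := (fun j => count_mem j w0).
Local Notation n := (size w0).
Hypothesis w0a : a \in w0.
Hypothesis w0b : all (fun b => a <= b <= a + i) w0.
Hypothesis c_mono : {homo c : j k / j <= k}.
Hypothesis uniq_Wl : uniq Wl.
Hypothesis WlE : forall w, (w \in Wl) =
  perm_eq w w0 && all (fun j => cdes (restrict j w) == c j) (iota 0 (a + i).+1).

Let n_gt0 : 0 < n. Proof. by case: w0 w0a. Qed.

Lemma size_Wl w : w \in Wl -> size w = n.
Proof. by rewrite WlE => /andP[/perm_size]. Qed.

Lemma shift_Wl k w : (shift k w \in Wl) = (w \in Wl).
Proof.
elim: k => //= k <-; rewrite !WlE perm_rot; congr (_ && _).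
by apply: eq_all => j; rewrite cdes_restrict_rot.
Qed.

Lemma sum_shift_Wl (V : nmodType) (f : seq nat -> V) k :
  (\sum_(w <- Wl) f (shift k w) = \sum_(w <- Wl) f w)%R.
Proof.
rewrite -(big_map (fun w => shift k w) xpredT f); apply: perm_big.
have uM : uniq [seq shift k w | w <- Wl] by rewrite map_inj_uniq //; exact: shift_inj.
rewrite uniq_perm // => w.
have sM : {subset [seq shift k w | w <- Wl] <= Wl}.
  by move=> _ /mapP[v vW ->]; rewrite shift_Wl.
have szM : size Wl <= size [seq shift k w | w <- Wl] by rewrite size_map.
by rewrite (uniq_min_size uM sM szM).2.
Qed.

(* Every word of the class has [al a] rotations starting with [a], among its [n] rotations
   counted with multiplicity. *)
Lemma double_count (V : nmodType) (g : seq nat -> V) :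
  {in Wl, forall w, g (rot 1 w) = g w} ->
  ((\sum_(w <- Wl) g w) *+ al a = (\sum_(w <- Wl | head a.+1 w == a) g w) *+ n)%R.
Proof.
move=> gR; have gS k : {in Wl, forall w, g (shift k w) = g w}.
  by move=> w wW; elim: k => //= k <-; rewrite gR ?shift_Wl.
transitivity (\sum_(w <- Wl) \sum_(0 <= k < n | head a.+1 (shift k w) == a) g (shift k w))%R.
  rewrite -sumrMnl; apply: eq_big_seq => w wW.
  rewrite (eq_bigr (fun=> g w)) => [|k _]; last exact: gS.
  rewrite -big_filter big_const_seq count_predT size_filter iter_addr addr0.
  congr (_ *+ _)%R; have /permP <- : perm_eq w w0 by move: wW; rewrite WlE => /andP[].
  have wE : w = [seq nth a.+1 w k | k <- iota 0 n] by rewrite -(size_Wl wW) -/(mkseq _ _) mkseq_nth.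
  rewrite {1}wE count_map /index_iota subn0; apply: eq_in_count => k.
  rewrite mem_iota add0n => /andP[_ kn] /=; rewrite shift_rot ?(size_Wl wW) ?(ltnW kn) //.
  by rewrite /rot -nth0 nth_cat size_drop (size_Wl wW) subn_gt0 kn nth_drop addn0.
rewrite (exchange_big_dep xpredT) //= -[n in RHS]subn0 -sumr_const_nat.
apply: eq_bigr => k _; rewrite big_mkcond [RHS]big_mkcond /=.
exact: (sum_shift_Wl (fun w => if head a.+1 w == a then g w else 0%R)).
Qed.

(** Below [a] all restrictions are empty, and the counts of the letters from [a] to [a + i] recover
    the rearrangement condition. *)
Lemma Wl_starts_at w : (w \in Wl) && (head a.+1 w == a) = starts_at a i al c w.
Proof.
rewrite WlE /starts_at andbC; congr (_ && _).
have lowE v j : all (fun b => a <= b <= a + i) v -> j < a -> restrict j v = [::].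
  move=> /allP va ja; apply/eqP; rewrite -[_ == _]negbK -has_filter.
  by apply/hasPn => b /va /andP[ab _]; rewrite -ltnNge (leq_trans ja).
apply/andP/andP => -[].
  move=> pw /allP cw; split; first by rewrite (perm_all _ pw).
  apply/allP => j; rewrite mem_iota => ji; rewrite (permP pw) eqxx.
  by apply: cw; rewrite mem_iota; lia.
move=> wb /allP cw; split.
  apply/allP => b; rewrite mem_cat => bw.
  have bi : b \in iota a i.+1.
    rewrite mem_iota addnS ltnS.
    by case/orP: bw => [/(allP wb)|/(allP w0b)].
  by have /andP[] := cw b bi.
apply/allP => j; rewrite mem_iota add0n => /= ji; case: (ltnP j a) => ja.
  by rewrite !lowE.
by have /cw/andP[] : j \in iota a i.+1 by rewrite mem_iota; lia.
Qed.

Variables (d : nat) (x : algC).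
Hypothesis x_prim : (d.-primitive_root x)%R.
Hypothesis dn : d %| n.

Let d_gt0 : 0 < d. Proof. exact: prim_order_gt0 x_prim. Qed.
Let al_gt0 : 0 < al a. Proof. by rewrite -has_count has_pred1. Qed.

Lemma fixed_wpow w : w \in Wl -> rot (n %/ d) w = w -> w = wpow (take (n %/ d) w) d.
Proof.
by move=> wW; apply: rot_fixed_wpow; rewrite (size_Wl wW) mulnC divnK.
Qed.

(** The fixed words are the powers v^d in the class, and taking the prefix of length n/d matches
    them with the words v whose data are divided by [d]. *)
Lemma size_fixed_start :
  size [seq w <- Wl | (head a.+1 w == a) && (rot (n %/ d) w == w)] =
  if all (fun j => (d %| al j) && (d %| c j)) (iota a i.+1)
  then size (ins_family a (fun j => al j %/ d) (fun j => c j %/ d) i) else 0.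
Proof.
set Lfix := filter _ _.
have LfixE w : w \in Lfix -> [/\ w \in Wl, starts_at a i al c w & w = wpow (take (n %/ d) w) d].
  rewrite mem_filter => /andP[/andP[wh /eqP wr] wW]; rewrite -Wl_starts_at wW wh.
  by split=> //; exact: fixed_wpow.
case: ifPn => dv; last first.
  case E : Lfix => [|w L] //; have /LfixE[_ + wE] : w \in Lfix by rewrite E mem_head.
  by rewrite wE starts_at_wpow // (negPf dv).
have adv : d %| al a.
  by have := allP dv a; rewrite mem_iota leqnn addnS ltnS leq_addr => /(_ isT)/andP[].
have uL : uniq Lfix by rewrite filter_uniq.
have uT : uniq [seq take (n %/ d) w | w <- Lfix].
  rewrite map_inj_in_uniq // => u v /LfixE[_ _ uE] /LfixE[_ _ vE] E.
  by rewrite uE E -vE.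
have al0 : 0 < al a %/ d by rewrite divn_gt0 // dvdn_leq.
rewrite (perm_size (@perm_family a i (fun j => al j %/ d) (fun j => c j %/ d) _ al0 uT _)) ?size_map // => v.
apply/mapP/idP => [[w /LfixE[_ + wE] ->]|vS].
  by rewrite {1}wE starts_at_wpow // dv.
have wS : starts_at a i al c (wpow v d) by rewrite starts_at_wpow // dv.
have /andP[wW wh] : (wpow v d \in Wl) && (head a.+1 (wpow v d) == a) by rewrite Wl_starts_at.
have sv : n %/ d = size v by rewrite -(size_Wl wW) size_wpow mulKn.
exists (wpow v d).
  by rewrite mem_filter wW wh sv rot_wpow eqxx.
by rewrite sv -(prednK d_gt0) wpowS take_size_cat.
Qed.

Local Open Scope ring_scope.

Lemma maj_sum_start : (d %| c (a + i))%N ->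
  \sum_(w <- Wl | head a.+1 w == a) x ^+ maj w =
  (size [seq w <- Wl | (head a.+1 w == a) && (rot (n %/ d) w == w)])%:R.
Proof.
move=> dc; rewrite size_fixed_start.
have -> : \sum_(w <- Wl | head a.+1 w == a) x ^+ maj w = family_gf a al c x i.
  rewrite /family_gf (perm_big _ (@perm_family a i al c [seq w <- Wl | head a.+1 w == a] al_gt0 _ _)) /=.
  - rewrite big_map big_filter big_seq_cond [RHS]big_seq_cond.
    apply: eq_bigr => w /andP[wW _]; have wn := size_Wl wW; rewrite -lmaj_maj.
    case: w wW wn => [|b s] _ wn; first by have := n_gt0; rewrite -wn.
    (* Closing the word changes [lmaj] by 0 or n, and x^n = 1. *)
    rewrite lmaj_rcons -[(size s).+1]/(size (b :: s)) wn exprD.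
    by have /dvdnP[m ->] := dn; rewrite -mulnA mulnCA exprM (prim_expr_order x_prim) expr1n mulr1.
  - by rewrite filter_uniq.
  - by move=> v; rewrite mem_filter andbC Wl_starts_at.
rewrite (family_gf_root x_prim) //.
  by case: ifP.
by rewrite /content_sum -(size_sum_count w0b).
Qed.

Lemma cdes_Wl w : w \in Wl -> cdes w = c (a + i).
Proof.
rewrite WlE => /andP[pw /allP/(_ (a + i)%N)]; rewrite mem_iota ltnS leqnn => /(_ isT)/eqP <-.
rewrite restrict_id // (perm_all _ pw).
by apply: sub_all w0b => b /andP[].
Qed.

Let fixed := \sum_(w <- Wl) (rot (n %/ d) w == w)%:R : algC.

Lemma maj_sum_Wl : \sum_(w <- Wl) x ^+ maj w = fixed.
Proof.
have rotE w : w \in Wl -> x ^+ maj w = x ^+ maj (rot 1 w) * x ^+ c (a + i).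
  move=> wW; rewrite -(cdes_Wl wW); have wn := size_Wl wW.
  case: w wW wn => [|b s] _ wn; first by have := n_gt0; rewrite -wn.
  rewrite -exprD -maj_rot1 wn exprD.
  by have /dvdnP[m ->] := dn; rewrite -mulnA mulnCA exprM (prim_expr_order x_prim) expr1n mulr1.
case: (boolP (d %| c (a + i))%N) => dc.
  (* After multiplication by [al a], both sums reduce by [double_count] to the words starting with
     [a]. *)
  apply: (pmulrnI al_gt0); rewrite /= /fixed !double_count; first last.
  - move=> w /rotE ->; have /eqP -> : x ^+ c (a + i) == 1; rewrite ?mulr1 //.
    by rewrite -(prim_order_dvd x_prim).
  - by move=> w _; rewrite rot_rot (inj_eq (@rot_inj 1 _)).
  rewrite maj_sum_start //; congr (_ *+ _).
  rewrite size_filter -sum1_count natr_sum [LHS]big_mkcond [RHS]big_mkcond /=.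
  by apply: eq_bigr => w _; case: (_ == a); case: (_ == w).
(* Rotating all words shows that the sum equals itself times [x ^+ c (a + i)], which differs from
   1. *)
transitivity (0 : algC).
  apply: (mulfI (x := x ^+ c (a + i) - 1)); first by rewrite subr_eq0 -(prim_order_dvd x_prim).
  rewrite mulr0 mulrBl mul1r; apply/eqP; rewrite subr_eq0; apply/eqP.
  rewrite -{1}(sum_shift_Wl _ 1) mulrC big_distrl /=.
  by apply: eq_big_seq => w /rotE.
rewrite /fixed big_seq big1 // => w wW; case: eqP => // wr; case/negP: dc.
by rewrite -(cdes_Wl wW) (fixed_wpow wW wr) cdes_wpow dvdn_mulr.
Qed.

Lemma flex_sum_Wl : \sum_(w <- Wl) x ^+ flex w = fixed.
Proof.
apply: (pmulrnI n_gt0); rewrite /= -[in LHS](subn0 n) -sumr_const_nat.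
(* Averaging over the n shifts lets each word contribute the sum over its whole orbit. *)
rewrite (eq_bigr (fun k => \sum_(w <- Wl) x ^+ flex (shift k w))); last first.
  by move=> k _; rewrite (sum_shift_Wl (fun w => x ^+ flex w)).
rewrite exchange_big /= /fixed -sumrMnl; apply: eq_big_seq => w wW.
have wn := size_Wl wW; rewrite -wn (orbit_flex_sum x_prim) ?wn //.
by rewrite natrM mulr_natr.
Qed.

End WordClass.

(** * Congruence modulo X^n - 1 from values at roots of unity *)

Lemma eq_mod_Xn_sub_1 n (p q : {poly int}) : 0 < n ->
  (forall (d : nat) (x : algC), d.-primitive_root x -> (d %| n)%N ->
     (map_poly intr p).[x] = (map_poly intr q).[x])%R ->
  eq_mod_poly ('X^n - 1)%R p q.
Proof.
move=> n0 pq; have mon : ('X^n - 1 : {poly int})%R \is monic by exact: monicXnsubC.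
exists (Pdiv.Ring.rdivp (p - q) ('X^n - 1))%R.
set r := Pdiv.Ring.rmodp (p - q)%R ('X^n - 1)%R.
have rE : (p - q = Pdiv.Ring.rdivp (p - q) ('X^n - 1) * ('X^n - 1) + r)%R.
  exact: Pdiv.RingMonic.rdivp_eq.
suff r0 : r = 0%R by rewrite {1}rE r0 addr0.
have sr : size r <= n.
  by rewrite -ltnS -(size_XnsubC (1 : int)%R n0) Pdiv.Ring.ltn_rmodpN0 // monic_neq0.
apply: (map_inj_poly (f := intr : int -> algC)) => //; first exact: intr_inj.
(* The remainder has degree below n but vanishes at the n distinct powers of [z], each a primitive
   d-th root of unity for some [d] dividing n. *)
rewrite rmorph0; have [z z_prim] := C_prim_root_exists n0.
apply/eqP; apply: contraTT isT => rn0.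
have := max_poly_roots rn0 (rs := [seq (z ^+ k)%R | k <- iota 0 n]).
rewrite size_map size_iota ltnNge (leq_trans (size_poly _ _)) // => H.
apply: H; last first.
  rewrite map_inj_in_uniq ?iota_uniq // => j k; rewrite !mem_iota => jn kn /eqP.
  by rewrite (eq_prim_root_expr z_prim) !modn_small // => /eqP.
apply/allP => _ /mapP[k _ ->]; rewrite /root.
have zk : ((z ^+ k) ^+ n = 1)%R by rewrite exprAC (prim_expr_order z_prim) expr1n.
have [d d_prim dn] := prim_order_exists n0 zk.
have -> : r = (p - q - Pdiv.Ring.rdivp (p - q) ('X^n - 1) * ('X^n - 1))%R.
  by rewrite {1}rE addrC addKr.
rewrite !rmorphB rmorphM /= !hornerE (pq _ _ d_prim) // subrr sub0r oppr_eq0 mulf_eq0.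
rewrite rmorphB rmorph1 /= map_polyXn !hornerE zk subrr eqxx orbT //.
Qed.

(** * The words of given content and cyclic descent type as one word class *)

Section MajorIndex.
Variables (alpha delta : seq nat).
Local Notation m := (size alpha).

Lemma size_base_word : size (base_word alpha) = sumn alpha.
Proof.
rewrite /base_word size_flatten /shape -map_comp; congr sumn.
rewrite -[RHS](mkseq_nth 0) /mkseq -[in LHS](addn0 1) iotaDl -map_comp.
by apply: eq_map => j /=; rewrite size_nseq.
Qed.

Lemma inW_size w : inW alpha delta w -> size w = sumn alpha.
Proof. by case/and3P=> w1 w2 _; rewrite (perm_size (perm_base_word w1 w2)) size_base_word. Qed.

Lemma restrict0 w : is_word w -> restrict 0 w = [::].
Proof. by elim: w => //= b w IH /andP[b0 /IH wE]; rewrite /restrict /= leqNgt b0. Qed.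

(** [CDT] lists successive differences starting from the empty word, so its partial sums are these
    numbers. *)
Lemma inW_cdes w v j : inW alpha delta w -> inW alpha delta v -> j <= m ->
  cdes (restrict j w) = cdes (restrict j v).
Proof.
case/and3P=> w1 _ /eqP wD /and3P[v1 _ /eqP vD].
elim: j => [|j IH] jm; first by rewrite !restrict0.
have jI : j < size (iota 1 m) by rewrite size_iota.
have := congr1 (fun s => nth 0%R s j) (etrans wD (esym vD)).
rewrite !(nth_map 0) // nth_iota // add1n /= IH; last exact: ltnW.
by move/addIr => [].
Qed.

Lemma inW_eq w v : inW alpha delta w ->
  inW alpha delta v =
  perm_eq v w && all (fun j => cdes (restrict j v) == cdes (restrict j w)) (iota 0 m.+1).
Proof.
move=> wW; apply/idP/andP => [vW|[pvw /allP cvw]].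
  split; last by apply/allP => j; rewrite mem_iota => jm; rewrite (inW_cdes vW wW).
  case/and3P: (wW) => w1 w2 _; case/and3P: (vW) => v1 v2 _.
  by rewrite (perm_trans (perm_base_word v1 v2)) // perm_sym perm_base_word.
case/and3P: wW => w1 /andP[w2 w3] w4; rewrite /inW /is_word /has_content.
rewrite !(perm_all _ pvw) [all _ w]w1 w2 /=; apply/andP; split.
  apply/eqP; rewrite -[RHS](eqP w3); apply: eq_map => j; exact: (permP pvw).
apply/eqP; rewrite -[RHS](eqP w4); apply/eq_in_map => j; rewrite mem_iota => jm.
by rewrite !(eqP (cvw _ _)) // mem_iota; lia.
Qed.

(** The increments are entries of [delta], hence nonnegative; beyond the number of parts,
    restriction changes nothing. *)
Lemma inW_cdes_mono w : inW alpha delta w ->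
  {homo (fun j => cdes (restrict j w)) : j k / j <= k}.
Proof.
case/and3P=> w1 /andP[w2 _] /eqP wD.
have step j : cdes (restrict j w) <= cdes (restrict j.+1 w).
  case: (ltnP j m) => jm; last first.
    by rewrite !restrict_id //; apply: sub_all w2 => b /= bm; lia.
  have := congr1 (fun s => nth 0%R s j) wD.
  rewrite (nth_map 0) ?size_iota // nth_iota // add1n /=.
  have [js|js] := ltnP j (size delta); last by rewrite nth_default ?size_map //; lia.
  by rewrite (nth_map 0) //; lia.
by apply: homo_leq => // ? ? ?; exact: leq_trans.
Qed.

Lemma flex_maj_prim_root (d : nat) (x : algC) :
  (d.-primitive_root x)%R -> d %| sumn alpha -> 0 < sumn alpha ->
  (\sum_(w <- W alpha delta) x ^+ flex w = \sum_(w <- W alpha delta) x ^+ maj w)%R.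
Proof.
move=> x_prim dn n0.
case E : (W alpha delta) => [|w0 L]; first by rewrite !big_nil.
have w0W : inW alpha delta w0 by rewrite -mem_W E mem_head.
rewrite -E; have sw := inW_size w0W.
have exa : exists a, a \in w0.
  by case: w0 sw {E w0W} n0 => [<-//|b s] _ _; exists b; rewrite mem_head.
case: (ex_minnP exa) => a aw amin.
have w0m : all (fun b => b <= m) w0 by case/and3P: w0W => _ /andP[].
have am : a + (m - a) = m by rewrite subnKC // (allP w0m).
have w0b : all (fun b => a <= b <= a + (m - a)) w0.
  by rewrite am; apply/allP => b bw; rewrite amin //= (allP w0m).
have WE w : (w \in W alpha delta) = perm_eq w w0 &&
    all (fun j => cdes (restrict j w) == cdes (restrict j w0)) (iota 0 (a + (m - a)).+1).
  by rewrite am mem_W (inW_eq w w0W).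
rewrite -sw in dn.
have mono := inW_cdes_mono w0W.
have uW := uniq_W alpha delta.
by rewrite (flex_sum_Wl aw uW WE x_prim dn) (maj_sum_Wl aw w0b mono uW WE x_prim dn).
Qed.

End MajorIndex.

Theorem theorem8p4 (n : nat) (alpha delta : seq nat)
    (n_ge1 : (1 <= n)%N) (alpha_n : sumn alpha = n) :
  eq_mod_poly ('X^n - 1)%R
    (\sum_(w <- W alpha delta) 'X^(flex w))%R
    (\sum_(w <- W alpha delta) 'X^(maj w))%R.
Proof.
apply: eq_mod_Xn_sub_1 => // d x x_prim dn; rewrite -alpha_n in dn n_ge1.
have E (g : seq nat -> nat) : ((map_poly intr (\sum_(w <- W alpha delta) 'X^(g w) : {poly int})).[x]
    = \sum_(w <- W alpha delta) x ^+ g w)%R.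
  rewrite rmorph_sum horner_sum; apply: eq_bigr => w _.
  by rewrite /= map_polyXn hornerXn.
by rewrite !E (flex_maj_prim_root _ x_prim).
Qed.
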